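(* Suppose $n\ge1$ i.i.d. paths of a Markov Reward Process are observed. If the sample mean estimator and the maximum likelihood estimator of the expected one-step reward vector are equal, then the maximum likelihood (ML) value estimator is equal to the Least-Squares Temporal Difference (LSTD) estimator.
   Context: A Markov Reward Process (MRP) has a finite state space $\mathbb S$, starting probabilities $p_i$, transition probabilities $p_{ij}$, random real rewards $R_{ij}$ received on a transition $i\to j$, and a discount $\gamma\in(0,1]$. The expected one-step reward vector $\mathbf r$ has entries $r_i=\sum_j p_{ij}\mathbb E[R_{ij}]$. The sample consists of $n$ i.i.d. paths, each run until a terminal state, with their rewards. Let $\bar p_{ij}=\mu_{ij}/K_i$ (with $\bar p_{ij}=0$ if $K_i=0$) be the ML estimate of $p_{ij}$, where $\mu_{ij}$ is the number of observed direct transitions $i\to j$ and $K_i$ the number of visits to $i$, and $\bar{\mathbf P}=(\bar p_{ij})$. The ML value estimator is $\bar{\mathbf V}=(\mathbf I-\gamma\bar{\mathbf P})^{-1}\bar{\mathbf r}$, where $\bar{\mathbf r}$ is the ML estimate of $\mathbf r$. The LSTD estimator (tabular case) is characterized as the unique solution $\bar{\mathbf V}$ of $\bar{\mathbf V}=\hat{\mathbf r}+\gamma\bar{\mathbf P}\bar{\mathbf V}$, where $\hat{\mathbf r}$ is the sample mean estimate of $\mathbf r$ ($\hat r_i$ is the average of the rewards observed on transitions leaving $i$). *)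

(* Defs.v *)
From mathcomp Require Import all_boot all_order all_algebra.
From mathcomp Require Import all_classical all_reals all_analysis.

Set Implicit Arguments.
Unset Strict Implicit.
Unset Printing Implicit Defensive.

Import Order.TTheory GRing.Theory Num.Theory.
Import numFieldNormedType.Exports.

Local Open Scope classical_set_scope.
Local Open Scope ring_scope.

(** ** Markov reward processes on the finite state space ['I_N] *)

(* A parametric model for the laws of the rewards: [rlaw th i j] is the law of
   the reward R_ij under the parameter [th], with density [rdens th i j] with
   respect to a dominating measure [rbase i j]. The latter need not be
   sigma-finite: the counting measure on R covers all discrete laws. A single
   fixed law is the case of a one-point parameter type, with the law dominating
   itself. *)
Record reward_family (R : realType) (N : nat) := RewardFamily {
  rparam : Type;
  rlaw : rparam -> 'I_N -> 'I_N -> probability (measurableTypeR R) R;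
  rbase : 'I_N -> 'I_N -> {measure set (measurableTypeR R) -> \bar R};
  rdens : rparam -> 'I_N -> 'I_N -> measurableTypeR R -> R;
  rdens_ge0 : forall th i j x, 0 <= rdens th i j x;
  measurable_rdens : forall th i j, measurable_fun [set: _] (rdens th i j);
  rlaw_rdens : forall th i j (A : set (measurableTypeR R)), measurable A ->
    rlaw th i j A = (\int[rbase i j]_(x in A) (rdens th i j x)%:E)%E;
  rlaw_integrable : forall th i j,
    (rlaw th i j).-integrable [set: _] (fun x : measurableTypeR R => (x : R)%:E)
}.

Record mrp (R : realType) (N : nat) (F : reward_family R N) := Mrp {
  start : 'I_N -> R;
  trans : 'I_N -> 'I_N -> R;
  rpar : rparam F
}.

(* A terminal state has no outgoing transition. *)
Definition is_mrp (R : realType) (N : nat) (F : reward_family R N)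
    (T : {set 'I_N}) (M : mrp F) : Prop :=
  [/\ (forall i, 0 <= start M i) /\ \sum_i start M i = 1,
      forall i j, 0 <= trans M i j,
      forall i, i \notin T -> \sum_j trans M i j = 1
    & forall i, i \in T -> forall j, trans M i j = 0].

Definition mean_reward (R : realType) (N : nat) (F : reward_family R N)
    (th : rparam F) (i j : 'I_N) : R :=
  fine (\int[rlaw th i j]_x (x : R)%:E)%E.

(** ** Paths and i.i.d. samples *)

(* The initial state, followed by the pairs (reward, next state). *)
Definition mrp_path (R : realType) (N : nat) : Type := ('I_N * seq (R * 'I_N))%type.

Definition visited (R : realType) (N : nat) (p : mrp_path R N) : seq 'I_N :=
  p.1 :: unzip2 p.2.

Definition rewards (R : realType) (N : nat) (p : mrp_path R N) : seq R :=
  unzip1 p.2.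

(* The transitions of a path, in the format (i, (reward, j)); [zip] drops the
   final state of [visited p]. *)
Definition steps (R : realType) (N : nat) (p : mrp_path R N) :
    seq ('I_N * (R * 'I_N)) :=
  zip (visited p) p.2.

Definition run_until (R : realType) (N : nat) (T : {set 'I_N}) (p : mrp_path R N) :
    Prop :=
  last p.1 (unzip2 p.2) \in T /\ all (fun t => t.1 \notin T) (steps p).

(* The paths with state sequence [i :: s] and [t]-th reward in [B t]. *)
Definition cylinder (R : realType) (N : nat) (i : 'I_N) (s : seq 'I_N)
    (B : nat -> set (measurableTypeR R)) : set (mrp_path R N) :=
  [set p | visited p = i :: s /\
           forall t, (t < size s)%N -> B t (nth 0 (rewards p) t)].

Definition cylinder_prob (R : realType) (N : nat) (F : reward_family R N)
    (T : {set 'I_N}) (M : mrp F) (i : 'I_N) (s : seq 'I_N)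
    (B : nat -> set (measurableTypeR R)) : \bar R :=
  ((start M i)%:E *
   (\prod_(t < size s)
      ((trans M (nth i (i :: s) t) (nth i s t))%:E *
       rlaw (rpar M) (nth i (i :: s) t) (nth i s t) (B t))) *
   (last i s \in T)%:R%:E)%E.

(* The cylinders, together with the empty set, form a pi-system generating the
   sigma-algebra of path space, so that [iid_law] determines the law of each
   path and [iid_indep] is mutual independence. *)
Record iid_paths (R : realType) (N : nat) (F : reward_family R N)
    (T : {set 'I_N}) (M : mrp F) (d : measure_display) (Omega : measurableType d)
    (P : probability Omega R) (n : nat) (X : 'I_n -> Omega -> mrp_path R N) :
    Prop := IidPaths {
  iid_run : forall k omega, run_until T (X k omega);
  iid_meas : forall k i s B, (forall t, measurable (B t)) ->
    measurable (X k @^-1` cylinder i s B);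
  iid_law : forall k i s B, (forall t, measurable (B t)) ->
    P (X k @^-1` cylinder i s B) = cylinder_prob T M i s B;
  iid_indep : forall (J : {set 'I_n}) (i : 'I_n -> 'I_N) (s : 'I_n -> seq 'I_N)
      (B : 'I_n -> nat -> set (measurableTypeR R)),
    (forall k t, measurable (B k t)) ->
    P (\bigcap_(k in [set` J]) (X k @^-1` cylinder (i k) (s k) (B k))) =
    (\prod_(k in J) P (X k @^-1` cylinder (i k) (s k) (B k)))%E
}.

(** ** Estimators, as functions of the observed sample [w] *)

Definition sample_steps (R : realType) (N n : nat) (w : 'I_n -> mrp_path R N) :
    seq ('I_N * (R * 'I_N)) :=
  flatten [seq steps (w k) | k <- enum 'I_n].

Definition num_visits (R : realType) (N n : nat) (w : 'I_n -> mrp_path R N)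
    (i : 'I_N) : nat :=
  (\sum_(k < n) count_mem i (visited (w k)))%N.

Definition num_trans (R : realType) (N n : nat) (w : 'I_n -> mrp_path R N)
    (i j : 'I_N) : nat :=
  count (fun t => (t.1 == i) && (t.2.2 == j)) (sample_steps w).

(* Since [0^-1 = 0], the entry is 0 when [i] is not visited. *)
Definition ML_trans (R : realType) (N n : nat) (w : 'I_n -> mrp_path R N) :
    'M[R]_N :=
  \matrix_(i, j) ((num_trans w i j)%:R / (num_visits w i)%:R).

(* The entry is 0 when no transition leaving [i] is observed. *)
Definition sample_mean_reward (R : realType) (N n : nat)
    (w : 'I_n -> mrp_path R N) : 'cV[R]_N :=
  \col_i ((\sum_(t <- sample_steps w | t.1 == i) t.2.1) /
          (count (fun t => t.1 == i) (sample_steps w))%:R).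

Definition likelihood (R : realType) (N : nat) (F : reward_family R N) (n : nat)
    (w : 'I_n -> mrp_path R N) (M : mrp F) : R :=
  \prod_(k < n)
    (start M (w k).1 *
     \prod_(t <- steps (w k))
       (trans M t.1 t.2.2 * rdens (rpar M) t.1 t.2.2 t.2.1)).

(* Maximizers of the likelihood over all the models with terminal states [T]. *)
Definition is_ML (R : realType) (N : nat) (F : reward_family R N)
    (T : {set 'I_N}) (n : nat) (w : 'I_n -> mrp_path R N) (M : mrp F) : Prop :=
  is_mrp T M /\ forall M' : mrp F, is_mrp T M' -> likelihood w M' <= likelihood w M.

(* The ML estimate of r, i.e., r evaluated at the ML estimates of the transition
   probabilities and of the reward parameter. The likelihood does not constrain
   the rows of [trans M] at unvisited states; [ML_trans] sets them to 0. *)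
Definition ML_reward (R : realType) (N : nat) (F : reward_family R N) (n : nat)
    (w : 'I_n -> mrp_path R N) (M : mrp F) : 'cV[R]_N :=
  \col_i \sum_j ML_trans w i j * mean_reward (rpar M) i j.

Definition ML_value (R : realType) (N : nat) (F : reward_family R N)
    (gamma : R) (n : nat) (w : 'I_n -> mrp_path R N) (M : mrp F) : 'cV[R]_N :=
  invmx (1%:M - gamma *: ML_trans w) *m ML_reward w M.

(* [unique Q V] means that V satisfies Q and is equal to any V' satisfying Q. *)
Definition is_LSTD (R : realType) (N : nat) (gamma : R) (n : nat)
    (w : 'I_n -> mrp_path R N) (V : 'cV[R]_N) : Prop :=
  unique (fun V' : 'cV[R]_N =>
            V' = sample_mean_reward w + gamma *: (ML_trans w *m V')) V.

(* Main.v *)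
Require Import Defs.
From mathcomp Require Import all_boot all_order all_algebra.
From mathcomp Require Import all_classical all_reals all_analysis.

Set Implicit Arguments.
Unset Strict Implicit.
Unset Printing Implicit Defensive.

Import Order.TTheory GRing.Theory Num.Theory.
Import numFieldNormedType.Exports.

Local Open Scope classical_set_scope.
Local Open Scope ring_scope.

(* Every observed path ends in a terminal state, so I - gamma P is injective for
   the ML estimate P: if 0 <> V = gamma P V, then, P being substochastic, the set
   where |V| is maximal is nonempty, consists of states with an outgoing
   observed transition, and is closed under observed transitions. Following a
   path to its end puts a terminal state into this set, a contradiction. *)

Section Sample.
Variables (R : realType) (N : nat).
Implicit Types (p : mrp_path R N) (S : pred 'I_N) (i j : 'I_N).

(** Each step starts in the state that the previous step entered, so once a step leaves [S],
    closedness carries membership on to the end of the path. *)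
Lemma closed_last p S :
  (forall t, t \in steps p -> S t.1 -> S t.2.2) ->
  has (fun t => S t.1) (steps p) -> S (last p.1 (unzip2 p.2)).
Proof.
case: p => x l; rewrite /steps /visited /=.
elim: l x => [|[r y] l IH] x //= closed hasS.
have closed' t : t \in zip (y :: unzip2 l) l -> S t.1 -> S t.2.2.
  by move=> tl; apply: closed; rewrite inE tl orbT.
case/orP: hasS => [Sx|/(IH y closed')//].
have Sy : S y by apply: (closed (x, (r, y))) Sx; rewrite mem_head.
(* If no step follows, [y] is the last state; otherwise the next step leaves [y] and provides the
   [has] that the induction hypothesis requires. *)
case: l => [//|[r' y'] l] in closed closed' IH *.
by apply: IH => //=; rewrite Sy.
Qed.

(** Every visit except the final one is the source of exactly one step. This is what makes the
    estimated rows substochastic. *)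
Lemma count_steps_le_visits p i :
  (count (fun t => t.1 == i) (steps p) <= count_mem i (visited p))%N.
Proof.
case: p => x l; rewrite /steps /visited /=.
by elim: l x => [|[r y] l IH] x //=; rewrite leq_add2l.
Qed.

Variables (n : nat) (w : 'I_n -> mrp_path R N).

Lemma sum_num_trans i :
  (\sum_j num_trans w i j)%N = count (fun t => t.1 == i) (sample_steps w).
Proof.
rewrite /num_trans; elim: (sample_steps w) => [|t l IH] /=.
  by rewrite big1.
rewrite big_split /= IH; congr addn.
case: (t.1 == i) => /=; last by rewrite big1.
rewrite (bigD1 t.2.2) //= eqxx big1 ?addn0// => j.
by rewrite eq_sym => /negPf ->.
Qed.

Lemma sum_num_trans_le i : (\sum_j num_trans w i j <= num_visits w i)%N.
Proof.
rewrite sum_num_trans /sample_steps /num_visits count_flatten -map_comp.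
rewrite sumnE big_map big_enum /=.
by apply: leq_sum => k _; exact: count_steps_le_visits.
Qed.

Lemma mem_sample_steps t :
  reflect (exists k, t \in steps (w k)) (t \in sample_steps w).
Proof.
apply: (iffP flatten_mapP) => [[k _ tk]|[k tk]]; exists k => //.
by rewrite mem_enum.
Qed.

Lemma ML_trans_ge0 i j : 0 <= ML_trans w i j.
Proof. by rewrite mxE divr_ge0. Qed.

Lemma sum_ML_trans_le1 i : \sum_j ML_trans w i j <= 1.
Proof.
under eq_bigr do rewrite mxE.
rewrite -mulr_suml -natr_sum.
(* At an unvisited state, division by zero gives a zero row. *)
have [->|v0] := eqVneq (num_visits w i) 0%N; first by rewrite invr0 mulr0.
by rewrite ler_pdivrMr ?mul1r ?ler_nat ?sum_num_trans_le// ltr0n lt0n.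
Qed.

Lemma ML_trans_neq0 t : t \in sample_steps w -> ML_trans w t.1 t.2.2 != 0.
Proof.
move=> tw; have pos : (0 < num_trans w t.1 t.2.2)%N.
  by rewrite -has_count; apply/hasP; exists t; rewrite ?eqxx.
have vpos : (0 < num_visits w t.1)%N.
  apply: leq_trans (sum_num_trans_le _); apply: (leq_trans pos).
  by rewrite (bigD1 t.2.2) //= leq_addr.
by rewrite mxE mulf_neq0 ?invr_eq0 ?pnatr_eq0 -?lt0n.
Qed.

Lemma ML_trans_step i j :
  ML_trans w i j != 0 -> exists2 t, t \in sample_steps w & t.1 = i.
Proof.
rewrite mxE mulf_eq0 negb_or pnatr_eq0 -lt0n -has_count => /andP[].
by case/hasP=> t tw /andP[/eqP ti _] _; exists t.
Qed.

Lemma ML_trans_terminal (T : {set 'I_N}) i j :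
  (forall k, run_until T (w k)) -> i \in T -> ML_trans w i j = 0.
Proof.
move=> run iT; apply/eqP; apply: contraT => /ML_trans_step[t].
move=> /mem_sample_steps[k tk] ti.
by have [_ /allP/(_ _ tk)] := run k; rewrite ti iT.
Qed.

Lemma ML_trans_fixpoint0 (T : {set 'I_N}) (gamma : R) (V : 'cV[R]_N) :
  (forall k, run_until T (w k)) -> 0 <= gamma <= 1 ->
  V = gamma *: (ML_trans w *m V) -> V = 0.
Proof.
move=> run /andP[g0 g1] VE.
have row i : V i 0 = gamma * \sum_j ML_trans w i j * V j 0.
  by rewrite {1}VE !mxE.
apply/eqP; apply: contraT => V0.
(* A nonzero entry serves twice: as the starting index of the arg max, and to make the maximum [m]
   positive. *)
have [i0 Vi0] : exists i, V i 0 != 0.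
  apply/existsP; apply: contraNT V0 => /existsPn V0.
  by apply/eqP/colP => i; rewrite mxE; apply/eqP; rewrite -[_ == _]negbK V0.
pose im := [arg max_(i > i0) `|V i 0|]%O; pose m := `|V im 0|.
have le_m i : `|V i 0| <= m.
  by rewrite /m /im; case: arg_maxP => // i1 _ /(_ i isT).
have m0 : 0 < m by rewrite (lt_le_trans _ (le_m i0)) ?normr_gt0.
pose S i := `|V i 0| == m.
have closed i j : S i -> ML_trans w i j != 0 -> S j.
  move=> /eqP Si ij.
  have ge0 k : true -> 0 <= ML_trans w i k * (m - `|V k 0|).
    by move=> _; rewrite mulr_ge0 ?ML_trans_ge0 ?subr_ge0.
  (* All terms are nonnegative, and since the row sum and [gamma] are at most 1, the sum is at most
     m - |V_i| = 0. Hence each term vanishes, and a positive weight forces |V_j| = m. *)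
  have : \sum_k ML_trans w i k * (m - `|V k 0|) = 0.
    apply/le_anti; rewrite sumr_ge0 // andbT.
    under eq_bigr do rewrite mulrBr.
    rewrite sumrB subr_le0 -mulr_suml.
    apply: (@le_trans _ _ m).
      by rewrite ler_piMl ?sum_ML_trans_le1 ?ltW.
    rewrite -[leLHS]Si row normrM (ger0_norm g0).
    apply: (le_trans (ler_piMl _ g1)) => //.
    apply: (le_trans (ler_norm_sum _ _ _)); apply: ler_sum => k _.
    by rewrite normrM ger0_norm ?ML_trans_ge0.
  move/eqP; rewrite psumr_eq0 // => /allP/(_ j (mem_index_enum j)) /=.
  by rewrite mulf_eq0 (negPf ij) subr_eq0 eq_sym.
have no_zero_row i : S i -> ~ (forall j, ML_trans w i j = 0).
  move=> /eqP Si row0; move: m0; rewrite -Si row big1 ?mulr0 ?normr0 ?ltxx//.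
  by move=> j _; rewrite row0 mul0r.
have [j ij] : exists j, ML_trans w im j != 0.
  apply/existsP; apply: contraT => /existsPn row0.
  case: (no_zero_row im (eqxx _)) => j.
  by apply/eqP; rewrite -[_ == _]negbK row0.
(* The path to follow is one that has a step out of the maximizing state [im]. *)
have [t /mem_sample_steps[k tk] tim] := ML_trans_step ij.
have [lastT _] := run k.
have Slast : S (last (w k).1 (unzip2 (w k).2)).
  apply: closed_last => [u uk Su|].
    by apply: closed Su _; apply/ML_trans_neq0/mem_sample_steps; exists k.
  by apply/hasP; exists t => //; rewrite tim /S.
by case: (no_zero_row _ Slast) => j'; exact: ML_trans_terminal lastT.
Qed.

Lemma unitmx_sub_ML_trans (T : {set 'I_N}) (gamma : R) :
  (forall k, run_until T (w k)) -> 0 <= gamma <= 1 ->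
  1%:M - gamma *: ML_trans w \in unitmx.
Proof.
(* Row-freeness concerns row vectors multiplied from the left; transposing turns these into the
   column vectors of the fixed-point equation. *)
move=> run g01; rewrite -unitmx_tr -row_free_unit; apply: inj_row_free => v.
move=> /(congr1 trmx); rewrite trmx_mul trmxK trmx0 mulmxBl mul1mx -scalemxAl.
move=> /eqP; rewrite subr_eq0 => /eqP /(ML_trans_fixpoint0 run g01).
by move=> /(congr1 trmx); rewrite trmxK trmx0.
Qed.

End Sample.

Theorem corollary6 (R : realType) (N : nat) (T : {set 'I_N})
    (F : reward_family R N) (M : mrp F) (gamma : R)
    (d : measure_display) (Omega : measurableType d) (P : probability Omega R)
    (n : nat) (X : 'I_n -> Omega -> mrp_path R N) :
  is_mrp T M ->
  0 < gamma <= 1 ->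
  (1 <= n)%N ->
  iid_paths T M P X ->
  forall (omega : Omega) (Mhat : mrp F),
    is_ML T (fun k => X k omega) Mhat ->
    sample_mean_reward (fun k => X k omega) =
      ML_reward (fun k => X k omega) Mhat ->
    is_LSTD gamma (fun k => X k omega)
      (ML_value gamma (fun k => X k omega) Mhat).
Proof.
move=> _ /andP[g0 g1] _ [run _ _ _] omega Mhat _ rE.
have U : 1%:M - gamma *: ML_trans (X^~ omega) \in unitmx.
  apply: (@unitmx_sub_ML_trans _ _ _ _ T) => [k|]; first exact: run.
  by rewrite ltW.
(* The equality of the two reward estimates enters here: it identifies the LSTD equation with the
   linear system that [ML_value] solves by inversion. *)
have solE V : V = sample_mean_reward (X^~ omega)
                  + gamma *: (ML_trans (X^~ omega) *m V) <->
    (1%:M - gamma *: ML_trans (X^~ omega)) *m V = ML_reward (X^~ omega) Mhat.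
  by rewrite -rE mulmxBl mul1mx -scalemxAl; split=> [{1}->|<-];
    rewrite ?addrK ?subrK.
split=> [|V /solE VE]; first by apply/solE; rewrite mulKVmx.
by rewrite /ML_value -VE mulKmx.
Qed.
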